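(* For every nonempty set $S\subseteq\mathbb{N}_0$, there exists a poset $P$ with $P^*=S$ if and only if there are infinitely many pairwise non-isomorphic posets $P$ with $P^*=S$.
   Context: Poset game on a (finite) poset $P$: a move chooses $p\in P$ and replaces $P$ by $P-p_\leq:=P\setminus\{p' : p\leq p'\}$. Nimber: $\mathcal{G}(\emptyset)=0$, $\mathcal{G}(P)=\mathrm{mex}(P^* )$, where $P^*=\{\mathcal{G}(P-p_\leq):p\in P\}$ is the option value set of $P$ and mex is the least nonnegative integer not in the set. $\mathbb{N}_0$ denotes the nonnegative integers. *)

(* Defs.v *)
From HB Require Import structures.
From mathcomp Require Import classical_sets.
From mathcomp Require Import all_boot all_order.

Set Implicit Arguments.
Unset Strict Implicit.
Unset Printing Implicit Defensive.

Import Order.TTheory.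
Local Open Scope order_scope.

Lemma mex_exists (s : seq nat) : exists n, n \notin s.
Proof.
exists (\max_(i <- s) i).+1; apply/negP => hs.
by have := @leq_bigmax_seq _ s predT id _ hs isT; rewrite ltnn.
Qed.

Definition mex (s : seq nat) : nat := ex_minn (mex_exists s).

Section PosetGame.
Variables (d : Order.disp_t) (P : finPOrderType d).

(* A position of the game on P is a subset A of P with the induced order;
   choosing p in A leaves move A p. *)
Definition move (A : {set P}) (p : P) : {set P} := [set x in A | ~~ (p <= x)].

Lemma card_move (A : {set P}) (p : P) : p \in A -> (#|move A p| < #|A|)%N.
Proof.
move=> pA; apply: proper_card; apply/properP; split.
  by apply/subsetP => x; rewrite inE => /andP[].
by exists p => //; rewrite inE lexx andbF.
Qed.

(* The recursion is on a bound on the number of remaining moves; nimberE is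
   the defining equation. *)
Fixpoint nimber_rec (n : nat) (A : {set P}) : nat :=
  if n is n'.+1 then mex [seq nimber_rec n' (move A p) | p in A] else 0%N.

Definition nimber (A : {set P}) : nat := nimber_rec #|A| A.

Lemma mex_nil : mex [::] = 0%N.
Proof. by rewrite /mex; case: ex_minnP => m _ /(_ 0%N isT); case: m. Qed.

Lemma nimber_rec_eq (m n : nat) (A : {set P}) :
  (#|A| <= m)%N -> (#|A| <= n)%N -> nimber_rec m A = nimber_rec n A.
Proof.
have card0 (k : nat) (B : {set P}) : #|B| = 0%N -> nimber_rec k B = 0%N.
  case: k => //= k cB.
  by rewrite (_ : image _ _ = [::]) ?mex_nil //; apply: size0nil; rewrite size_image.
elim: m n A => [|m IHm] [|n] A //.
- by rewrite leqn0 => /eqP cA _; rewrite !card0.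
- by move=> _; rewrite leqn0 => /eqP cA; rewrite !card0.
move=> leAm leAn /=; congr mex; apply/eq_in_map => p; rewrite mem_enum => pA.
by apply: IHm; rewrite -ltnS; apply: leq_trans (card_move pA) _.
Qed.

Lemma nimberE (A : {set P}) :
  nimber A = mex [seq nimber (move A p) | p in A].
Proof.
rewrite /nimber (@nimber_rec_eq _ #|A|.+1) //=; congr mex.
apply/eq_in_map => p; rewrite mem_enum => pA.
by apply: nimber_rec_eq => //; apply: ltnW; apply: card_move.
Qed.

Lemma nimber0 : nimber set0 = 0%N.
Proof. by rewrite /nimber cards0. Qed.

End PosetGame.

Definition option_values (d : Order.disp_t) (P : finPOrderType d) : set nat :=
  [set n | exists p : P, n = nimber (move [set: P]%SET p)]%classic.

Definition poset_iso (d : Order.disp_t) (P Q : finPOrderType d) : Prop :=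
  exists2 f : P -> Q, bijective f & {mono f : x y / x <= y}.

(* Main.v *)
(** Replace a maximal element [m] of [P] by an antichain of [2k+1] copies of it.
    A position of the new game has the same nimber as the position of [P] in
    which [m] survives iff the number of surviving copies is odd: removing a
    copy either imitates the removal of [m], or it turns an even number of
    copies into an odd one, in which case the removal of another copy restores
    the nimber.  Hence the option values do not change, while the cardinal
    [#|P| + 2k] does. *)
From HB Require Import structures.
Require Import Defs.
From mathcomp Require Import classical_sets.
From mathcomp Require Import all_boot all_order.

Set Implicit Arguments.
Unset Strict Implicit.
Unset Printing Implicit Defensive.

Import Order.TTheory.
Local Open Scope order_scope.

Lemma mex_notin (s : seq nat) : mex s \notin s.
Proof. by rewrite /mex; case: ex_minnP. Qed.

Lemma mem_lt_mex (s : seq nat) (n : nat) : (n < mex s)%N -> n \in s.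
Proof.
rewrite /mex; case: ex_minnP => k _ kmin; rewrite ltnNge.
by apply: contraR => /kmin.
Qed.

Lemma mex_eq (s t : seq nat) :
  {subset t <= s} -> mex t \notin s -> mex s = mex t.
Proof.
move=> ts tNs; apply/eqP; rewrite eqn_leq; apply/andP; split; rewrite leqNgt.
  by apply: contra tNs => /mem_lt_mex.
by apply/negP => /mem_lt_mex/ts; apply/negP/mex_notin.
Qed.

Lemma nimber_move_neq (d : Order.disp_t) (P : finPOrderType d)
  (A : {set P}) (p : P) : p \in A -> nimber (move A p) <> nimber A.
Proof.
move=> pA e; have := mex_notin [seq nimber (move A q) | q in A].
by rewrite -nimberE -e => /negP; apply; apply: image_f.
Qed.

(** An alias of [T] that records [f], so that an order depending on [f] can be attached to it. Each
    point of [P] is blown up to the antichain of its preimages. *)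
Definition inflation (d : Order.disp_t) (P : finPOrderType d) (T : finType)
  (f : T -> P) : Type := T.

Section InflationOrder.
Variables (d : Order.disp_t) (P : finPOrderType d) (T : finType) (f : T -> P).

HB.instance Definition _ := Finite.on (inflation f).

Definition inflation_lt : rel (inflation f) := fun a b => f a < f b.
Definition inflation_le : rel (inflation f) :=
  fun a b => (a == b) || inflation_lt a b.

Lemma inflation_lt_irr : irreflexive inflation_lt.
Proof. by move=> a; rewrite /inflation_lt ltxx. Qed.

Lemma inflation_lt_trans : transitive inflation_lt.
Proof. by move=> b a c; apply: lt_trans. Qed.

HB.instance Definition _ := Order.LtLe_isPOrder.Build d (inflation f)
  (fun _ _ => erefl) inflation_lt_irr inflation_lt_trans.

Lemma inflation_leE (a b : inflation f) : (a <= b) = (a == b) || (f a < f b).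
Proof. by []. Qed.

End InflationOrder.

Section InflationNimber.
Variables (d : Order.disp_t) (P : finPOrderType d) (T : finType) (f : T -> P).

Hypothesis fiber1_or_max : forall (a b : T) (y : P),
  a != b -> f a = f b -> ~~ (f a < y).

Definition fiber (A : {set inflation f}) (y : P) : {set inflation f} :=
  [set a in A | f a == y].

Definition odd_fibers (A : {set inflation f}) : {set P} :=
  [set y | odd #|fiber A y|].

(** The fiber over [f p] is an antichain, so it loses only [p] and changes parity; fibers strictly
    above are emptied, the others stay intact. *)
Lemma odd_fibers_move (A : {set inflation f}) (p : inflation f) (y : P) :
  p \in A ->
  (y \in odd_fibers (move A p)) =
    if y == f p then f p \notin odd_fibers A
    else (y \in odd_fibers A) && ~~ (f p < y).
Proof.
move=> pA; rewrite !inE; case: eqVneq => [->|yp].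
  rewrite [in RHS](cardsD1 p) inE pA eqxx /= negbK; congr (odd #|pred_of_set _|).
  apply/setP => a; rewrite !inE inflation_leE [a == p]eq_sym negb_or.
  case: (a \in A) => //=; last by rewrite andbF.
  by case: (eqVneq (f a) (f p)) => [->|]; rewrite ?ltxx ?andbF ?andbT.
case: (boolP (f p < y)) => [py|npy]; rewrite ?andbF ?andbT.
  rewrite (_ : fiber _ _ = set0) ?cards0 //; apply/setP => a; rewrite !inE.
  rewrite inflation_leE; case: (eqVneq (f a) y) => [->|]; rewrite ?andbF //.
  by rewrite py orbT andbF.
congr (odd #|pred_of_set _|); apply/setP => a; rewrite !inE inflation_leE.
case: (eqVneq (f a) y) => [ay|]; rewrite ?andbF // ay (negPf npy) orbF.
by rewrite (_ : (p == a) = false) ?andbT //; apply: contraNF yp => /eqP ->; rewrite ay.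
Qed.

Lemma odd_fibers_move_odd (A : {set inflation f}) (p : inflation f) :
  p \in A -> f p \in odd_fibers A ->
  odd_fibers (move A p) = move (odd_fibers A) (f p).
Proof.
move=> pA fpA; apply/setP => y; rewrite odd_fibers_move // [in RHS]inE.
rewrite [f p <= y]le_eqVlt eq_sym negb_or.
by case: eqVneq => [<-|_] /=; rewrite ?fpA ?andbF.
Qed.

(* An even nonempty fiber has two elements, so that it lies over a maximal
   element of [P]. *)
Lemma odd_fibers_move_even (A : {set inflation f}) (p : inflation f) :
  p \in A -> f p \notin odd_fibers A ->
  f p \in odd_fibers (move A p) /\
  move (odd_fibers (move A p)) (f p) = odd_fibers A.
Proof.
move=> pA fpA; split; first by rewrite odd_fibers_move // eqxx.
have fp_max y : ~~ (f p < y).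
  move: (fpA); rewrite inE (cardsD1 p) inE pA eqxx /= negbK => odd_rest.
  have /card_gt0P[a] : (0 < #|fiber A (f p) :\ p|)%N by case: #|_| odd_rest.
  rewrite !inE => /and3P[ap _ /eqP fap].
  by apply: (fiber1_or_max (b := a)); rewrite // eq_sym.
(* Nothing lies above [f p], so the first move only adds [f p] to the odd fibers and the second only
   takes it away again. *)
apply/setP => y; rewrite [in LHS]inE odd_fibers_move //.
rewrite [f p <= y]le_eqVlt eq_sym (negPf (fp_max y)) orbF andbT.
by case: eqVneq => [<-|_] /=; rewrite ?andbT ?andbF ?(negPf fpA).
Qed.

Lemma nimber_odd_fibers (A : {set inflation f}) :
  nimber A = nimber (odd_fibers A).
Proof.
have [n] := ubnP #|A|; elim: n A => // n IHn A /ltnSE leAn.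
have IH p : p \in A -> nimber (move A p) = nimber (odd_fibers (move A p)).
  by move=> pA; apply: IHn; apply: leq_trans (card_move pA) leAn.
rewrite [LHS]nimberE [RHS]nimberE; apply: mex_eq.
  (* An odd fiber is nonempty, so every move in [odd_fibers A] is imitated by a move in [A]. *)
  move=> _ /imageP[x xA ->]; have := xA; rewrite inE => odd_x.
  have /card_gt0P[p] : (0 < #|fiber A x|)%N by case: #|_| odd_x.
  rewrite inE => /andP[pA /eqP fp]; rewrite -fp in xA *.
  by apply/imageP; exists p; rewrite // IH // odd_fibers_move_odd.
rewrite -nimberE; apply/negP => /imageP[p pA]; rewrite IH //.
have [fpA|fpA] := boolP (f p \in odd_fibers A).
  by rewrite odd_fibers_move_odd // => /esym; apply: nimber_move_neq.
(* [odd_fibers A] is itself an option of the new position, so their nimbers differ. *)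
by have [fpM <-] := odd_fibers_move_even pA fpA; apply: nimber_move_neq.
Qed.

Lemma option_values_inflation :
  (forall y : P, odd #|fiber [set: inflation f]%SET y|) ->
  option_values (inflation f) = option_values P.
Proof.
move=> odd_all.
have oT : odd_fibers [set: inflation f]%SET = [set: P]%SET.
  by apply/setP => y; rewrite !inE odd_all.
have moveE p : nimber (move [set: inflation f]%SET p)
             = nimber (move [set: P]%SET (f p)).
  by rewrite nimber_odd_fibers odd_fibers_move_odd ?oT ?inE.
apply/seteqP; split=> n [].
  by move=> p ->; exists (f p); rewrite moveE.
move=> x ->; have := odd_all x.
have [->|[p]] := set_0Vmem (fiber [set: inflation f]%SET x).
  by rewrite cards0.
by rewrite inE => /andP[_ /eqP <-] _; exists p; rewrite moveE.
Qed.

End InflationNimber.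

Lemma exists_maximal (d : Order.disp_t) (P : finPOrderType d) (p : P) :
  exists m : P, forall y, ~~ (m < y).
Proof.
have [n] := ubnP #|[set y | p < y]%SET|; elim: n p => // n IHn p /ltnSE le_n.
have [/existsP[q pq]|] := boolP [exists q, p < q]; last first.
  by rewrite negb_exists => /forallP; exists p.
apply: (IHn q); apply: leq_trans le_n; apply: proper_card.
apply/properP; split; last by exists q; rewrite inE ?ltxx.
by apply/subsetP => y; rewrite !inE; apply: lt_trans.
Qed.

Definition add_copies (d : Order.disp_t) (P : finPOrderType d) (m : P) (n : nat)
  (a : P + 'I_n) : P := if a is inl x then x else m.
Arguments add_copies {d P} m n a.

Lemma card_fiber_add_copies (d : Order.disp_t) (P : finPOrderType d) (m : P)
  (n : nat) (y : P) :
  #|fiber [set: inflation (add_copies m n)]%SET y| = ((y == m) * n).+1.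
Proof.
rewrite -sum1dep_card.
rewrite (eq_bigl (fun a => add_copies m n a == y)); last by move=> a; rewrite inE.
rewrite big_sumType /= big_pred1_eq -[m == y]eq_sym add1n; congr _.+1.
case: eqVneq => _; last by rewrite big_pred0.
by rewrite sum1_card card_ord mul1n.
Qed.

Lemma poset_iso_card (d : Order.disp_t) (P Q : finPOrderType d) :
  poset_iso P Q -> #|P| = #|Q|.
Proof. by move=> [f /bij_eq_card]. Qed.

Theorem theorem5 (d : Order.disp_t) (S : set nat) (S_nonempty : (S !=set0)%classic) :
  (exists P : finPOrderType d, option_values P = S) <->
  (exists F : nat -> finPOrderType d,
     (forall i : nat, option_values (F i) = S) /\
     (forall i j : nat, i <> j -> ~ poset_iso (F i) (F j))).
Proof.
split=> [[P PS]|[F [FS _]]]; last by exists (F 0%N).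
have [m m_max] : exists m : P, forall y, ~~ (m < y).
  (* An element of [S] is the value of some move, so [P] has a point to start from. *)
  by move: S_nonempty; rewrite -PS => -[_ [p _]]; apply: exists_maximal p.
exists (fun i => inflation (add_copies m i.*2)); split=> [i|i j ij].
  rewrite option_values_inflation // => [a b y|y]; last first.
    by rewrite card_fiber_add_copies /= oddM odd_double andbF.
  (* Of two distinct points with the same image at least one is an added copy, so that image is
     [m]. *)
  by case: a b => [a|a] [b|b] //= ab eab; [rewrite eab eqxx in ab | rewrite eab].
(* Isomorphic members would give [#|P| + i.*2 = #|P| + j.*2]. *)
move/poset_iso_card; rewrite !card_sum !card_ord => /addnI/double_inj.
exact: ij.
Qed.
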